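(* Let $1\le d\le n$, $d\le m$, let $\prec,\widetilde{\prec}\in B(n,d)$ and $\prec',\prec''\in B(m,d)$, and let $0\le j\le n-d$. Then the insertion operations are monotone for the flip order $\le_{\mathrm{fl}}$, i.e. $$\prec'\ \le_{\mathrm{fl}}\ \prec''\ \Longrightarrow\ \prec\circ_j\prec'\ \le_{\mathrm{fl}}\ \prec\circ_j\prec'',$$ and $$\prec\ \le_{\mathrm{fl}}\ \widetilde{\prec}\ \Longrightarrow\ \prec\circ_j\prec'\ \le_{\mathrm{fl}}\ \widetilde{\prec}\circ_j\prec'.$$
   Context: **Notation.** $[n]=\{1,\dots,n\}$, $[0]=\emptyset$; for an integer $a$, $a+[n]=\{a+1,\dots,a+n\}$; $\binom{[n]}{d}$ is the set of $d$-element subsets of $[n]$. **Higher Bruhat orders.** Let $1\le d\le n$. For $\mathbf i=\{i_1<\dots<i_{r}\}$ let $\hat{\mathbf i}_k=\mathbf i\setminus\{i_k\}$; the packet of $\mathbf i$ is the sequence $P(\mathbf i)=(\hat{\mathbf i}_{r},\hat{\mathbf i}_{r-1},\dots,\hat{\mathbf i}_1)$. A linear order on $\binom{[n]}{d}$ is admissible if for every $\mathbf i\in\binom{[n]}{d+1}$ its restriction to $P(\mathbf i)$ is either lexicographical ($\hat{\mathbf i}_{d+1}\prec\cdots\prec\hat{\mathbf i}_1$) or antilexicographical ($\hat{\mathbf i}_{d+1}\succ\cdots\succ\hat{\mathbf i}_1$). Its inversion set $Inv\subset\binom{[n]}{d+1}$ consists of those $\mathbf i$ for which the restriction to $P(\mathbf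 i)$ is antilexicographical. $B(n,d)$ is the set of admissible orders modulo the relation of having the same inversion set; so an element of $B(n,d)$ is determined by its inversion set. A known theorem of Ziegler says that $I\subset\binom{[n]}{d+1}$ is the inversion set of an element of $B(n,d)$ if and only if for each $\mathbf i\in\binom{[n]}{d+2}$ the set $I\cap P(\mathbf i)$ is an initial or a final segment (possibly empty or everything) of the sequence $P(\mathbf i)$. **Flip order.** For $b,b'\in B(n,d)$, $b'$ is obtained from $b$ by an increasing flip if $Inv(b')=Inv(b)\sqcup\{K\}$ for a single $K\in\binom{[n]}{d+1}\setminus Inv(b)$. The flip order $\le_{\mathrm{fl}}$ on $B(n,d)$ is the reflexive–transitive closure of the increasing flips: $b\le_{\mathrm{fl}}b'$ iff there is a finite (possibly empty) sequence of increasing flips, through elements of $B(n,d)$, from $b$ to $b'$. **Insertion.** Let $n,m\ge d$, $0\le j\le n-d$, $\prec\in B(n,d)$, $\prec'\in B(m,d)$. Write $[n+m-d]=A\sqcup B\sqcup C$ with $A=[j]$, $B=j+[m]$, $C=j+m+[n-(j+d)]$, and let $D=j+[d]\subset B$. Let $\phi:[n]\to A\cup D\cup C$ be the monotone bijection. Then $\prec\circ_j\prec'\in B(n+m-d,d)$ is the element whose inversion set is the set of $(d+1)$-subsets $L\subset[n+m-d]$ such that: (i) if $L\subset B$: $L-j\in Inv(\prec')$; (ii) if $L\subset A\cup D\cup C$: $\phi^{-1}(L)\in Inv(\prec)$; (iii) otherwise: $\phi^{-1}(\overline L)\in Inv(\prec)$, where $L^+=L\cap(A\cup D\cup C)$,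 $L^-=L\cap(B\setminus D)$, and $\overline L$ is the union of $L^+$ with the $|L^-|$ rightmost (largest) elements of $D\setminus L^+$. *)

(* Defs.v *)
From mathcomp Require Import all_boot.
From Stdlib Require Import Relation_Operators.

Set Implicit Arguments.
Unset Strict Implicit.
Unset Printing Implicit Defensive.

(* [n] is rendered as 'I_n, i.e. it is numbered from 0. *)

Definition ksubsets (n k : nat) : {set {set 'I_n}} :=
  [set S : {set 'I_n} | #|S| == k].

(* [enum K] is increasing, so this removes the largest element of K first:
   it lists the subsets K \ {k} in lexicographical order. *)
Definition packet (n : nat) (K : {set 'I_n}) : seq {set 'I_n} :=
  [seq K :\ k | k <- rev (enum K)].

Definition linear_order_on (T : finType) (D : {set T}) (r : rel T) : Prop :=
  [/\ {in D &, antisymmetric r}, {in D & &, transitive r} & {in D &, total r}].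

Definition lexicographical (n : nat) (r : rel {set 'I_n}) (K : {set 'I_n}) :=
  sorted r (packet K).

Definition antilexicographical (n : nat) (r : rel {set 'I_n})
    (K : {set 'I_n}) :=
  sorted r (rev (packet K)).

Definition admissible (n d : nat) (r : rel {set 'I_n}) : Prop :=
  linear_order_on (ksubsets n d) r /\
  {in ksubsets n d.+1,
    forall K, lexicographical r K || antilexicographical r K}.

Definition inversions (n d : nat) (r : rel {set 'I_n}) : {set {set 'I_n}} :=
  [set K in ksubsets n d.+1 | antilexicographical r K].

(* An element of B(n,d), i.e. a class of admissible orders having the same
   inversion set, is represented by that inversion set. *)
Definition higher_bruhat (n d : nat) (b : {set {set 'I_n}}) : Prop :=
  exists2 r : rel {set 'I_n}, admissible d r & inversions d r = b.

Definition increasing_flip (n d : nat) (b b' : {set {set 'I_n}}) : Prop :=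
  [/\ higher_bruhat d b, higher_bruhat d b' &
      exists2 K, K \in ksubsets n d.+1 :\: b & b' = K |: b].

(* The first conjunct matters only for the empty sequence of flips: it makes
   this a relation on B(n,d) rather than on all families of subsets. *)
Definition flip_le (n d : nat) (b b' : {set {set 'I_n}}) : Prop :=
  higher_bruhat d b /\ clos_refl_trans _ (@increasing_flip n d) b b'.

Definition blockA (N j : nat) : {set 'I_N} := [set x : 'I_N | x < j].
Definition blockB (N m j : nat) : {set 'I_N} := [set x : 'I_N | j <= x < j + m].
Definition blockC (N m j : nat) : {set 'I_N} := [set x : 'I_N | j + m <= x].
Definition blockD (N d j : nat) : {set 'I_N} := [set x : 'I_N | j <= x < j + d].

(* The monotone bijection from [n] to the union of A, D and C, on values. *)
Definition phi (m d j i : nat) : nat := if i < j + d then i else i + (m - d).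

Definition preimage (k N : nat) (f : nat -> nat) (L : {set 'I_N}) :
    {set 'I_k} :=
  [set i : 'I_k | [exists x in L, x == f i :> nat]].

Definition rightmost (N k : nat) (S : {set 'I_N}) : {set 'I_N} :=
  [set x in drop (#|S| - k) (enum S)].

Definition insertion_bar (N m d j : nat) (L : {set 'I_N}) : {set 'I_N} :=
  let D := blockD N d j in
  let Lplus := L :&: (blockA N j :|: D :|: blockC N m j) in
  let Lminus := L :&: (blockB N m j :\: D) in
  Lplus :|: rightmost #|Lminus| (D :\: Lplus).

Definition insertion (n m d j : nat) (b : {set {set 'I_n}})
    (b' : {set {set 'I_m}}) : {set {set 'I_(n + m - d)}} :=
  let N := n + m - d in
  [set L in ksubsets N d.+1 |
    if L \subset blockB N m j then preimage m (addn j) L \in b'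
    else if L \subset blockA N j :|: blockD N d j :|: blockC N m j then
      preimage n (phi m d j) L \in b
    else preimage n (phi m d j) (insertion_bar m d j L) \in b].

(* Main.v *)
Require Import Defs.
From mathcomp Require Import all_boot.
From mathcomp Require Import zify.
From Stdlib Require Import Relation_Operators.

(** Everything is done with inversion sets.  By Ziegler's criterion, proved
    here as [higher_bruhatP], a family of (d+1)-subsets is an element of B(n,d)
    if and only if it is consistent: for x < y < z in K, it never happens that
    the family contains K \ x and K \ z but not K \ y, or K \ y but neither of
    K \ x and K \ z.  So it suffices to show that the insertion of two consistent
    families is consistent ([insertion_bruhat]), and that a single flip of
    either argument turns into a chain of flips of the insertion
    ([insertion_flip_inner], [insertion_flip_outer]); chains compose
    ([flip_le_lift]).

    The operation L |-> bar L pushes the part of L inside B to the right end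
    of D.  There is a threshold c such that bar L agrees with L outside the
    zone [j + c, j + m) and meets the zone in [j + c, j + d).  When K has d + 2
    elements, at least two of them outside B, and c is the largest threshold of
    K, then bar (K \ x) is bar K minus the image of x under the weakly
    increasing map that collapses the zone onto j + c ([packet_wide]).  Hence
    the packet of K in the insertion is a weakly increasing relabelling of the
    packet of bar K in the outer family, and consistency is inherited
    ([glue_consistent]).  Any other K lies in B, where the inner family
    decides, or has one point v outside B, and then all sets K \ u with
    u <> v have the same bar, namely v together with D.

    A flip of the inner family adds one set to the insertion.  A flip of the
    outer family at F adds all the sets L outside B with bar L = F, in general
    many of them; they are added one by one in the order of a rank function f
    ([flip_le_by_rank]).  The intermediate families are consistent as soon as
    f is compatible with every packet that contains two added sets: there the
    new sets must come in from the end of the packet that already belongs to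
    the family.  Such an f exists ([flip_rank]).  If D is contained in F, then
    F = v together with D, the added sets are v together with the d-subsets
    of B, and f comes from an admissible order with the inner family as its
    inversion set, reversed if v lies to the right of B.  Otherwise let y be the
    last point of D missing from F.  Every packet with two added sets is sent
    by bar to the packet of F together with y, so the end at which the
    additions must start is the same for all packets; f is the rank in an
    admissible order of the (d+1)-subsets with no inversion, or its reverse. *)

Set Implicit Arguments.
Unset Strict Implicit.
Unset Printing Implicit Defensive.

(** * Consistent families are inversion sets *)

Section Consistency.

Variable n : nat.
Implicit Types (X K L T : {set 'I_n}) (P : pred {set 'I_n}).

(** Equivalent to: each packet meets P in an initial or a final segment.  A 0-1
    sequence is of that form exactly when it has no subsequence 010 or 101, and
    this local form is what the proofs manipulate. *)
Definition consistent_on X (d : nat) P := forall K (x y z : 'I_n),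
  K \subset X -> #|K| = d.+2 -> x \in K -> y \in K -> z \in K ->
  x < y -> y < z -> P (K :\ x) = P (K :\ z) -> P (K :\ y) = P (K :\ x).

(** An admissible linear order in numerical form: f is the position of a set
    in the order, and P consists of the sets whose packet is reversed. *)
Definition ranks_on X (d : nat) P (f : {set 'I_n} -> nat) :=
  {in [pred T : {set 'I_n} | (T \subset X) && (#|T| == d)] &, injective f} /\
  forall K (p q : 'I_n), K \subset X -> #|K| = d.+1 ->
    p \in K -> q \in K -> p < q -> P K = (f (K :\ p) < f (K :\ q)).

Lemma ord_ltn_neq (p q : 'I_n) : p < q -> p != q.
Proof. by rewrite -val_eqE /=; lia. Qed.

Lemma cardD1_in K x k : x \in K -> #|K| = k.+1 -> #|K :\ x| = k.
Proof. by move=> xK; rewrite (cardsD1 x) xK => -[]. Qed.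

Lemma setD1_swap K (x y : 'I_n) : K :\ x :\ y = K :\ y :\ x.
Proof. by rewrite !setDDl setUC. Qed.

Lemma setU1D1 K (x y : 'I_n) : x != y -> (x |: K) :\ y = x |: (K :\ y).
Proof.
move=> xy; apply/setP=> z; rewrite !inE.
by case: (z =P x) => [->|]; rewrite ?xy ?orbF // andbT.
Qed.

Lemma setD1_inj K (x y : 'I_n) : x \in K -> K :\ x = K :\ y -> x = y.
Proof.
move=> xK /setP/(_ x); by rewrite !inE eqxx xK andbT /=; case: eqP.
Qed.

(** Removing two of x, y, z from K leaves three sets, and the packets of K \ x,
    K \ y, K \ z compare them pairwise; a pattern 010 or 101 would order the
    three sets cyclically. *)
Lemma ranks_consistent X d P f : ranks_on X d P f -> consistent_on X d P.
Proof.
move=> [_ Pf] K x y z KX cK xK yK zK xy yz.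
have sub w : K :\ w \subset X by apply: subset_trans (subD1set _ _) KX.
have ne (u v : 'I_n) : u < v -> (u != v) && (v != u).
  by move/ord_ltn_neq => H; rewrite H eq_sym.
have xz := ltn_trans xy yz.
rewrite (Pf (K :\ x) y z) ?(Pf (K :\ y) x z) ?(Pf (K :\ z) x y) //;
  try exact: cardD1_in; rewrite ?inE ?xK ?yK ?zK ?andbT;
  try by case/andP: (ne _ _ xy); try by case/andP: (ne _ _ yz);
  try by case/andP: (ne _ _ xz).
rewrite (setD1_swap _ x y) (setD1_swap _ x z) (setD1_swap _ y z).
by lia.
Qed.

Definition below k : {set 'I_n} := [set x : 'I_n | x < k].

(** Induction on the ground set.  Let t be the new largest point.  The sets T
    with and without t carry orders given by the induction hypothesis, the
    former for the link of t.  If K contains t, its packet compares K \ t with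
    all the other K \ p at once: K \ t is below all of them when K is not in P,
    and above when it is.  So the order has to be: the T avoiding t with T + t
    outside P, the sets containing t, the T avoiding t with T + t in P.  That
    this respects the order among the sets avoiding t is the consistency of
    the packets of K + t. *)
Lemma consistent_ranks_below k d P :
  k <= n -> consistent_on (below k) d P ->
  exists f, ranks_on (below k) d P f.
Proof.
elim: k d P => [|k IH] d P kn Pc.
  exists (fun=> 0); split=> [S T|K p q] /=.
    rewrite !inE => /andP[/subsetP S0 _] /andP[/subsetP T0 _] _; apply/setP=> x.
    by apply/idP/idP => [/S0|/T0]; rewrite inE.
  by move=> /subsetP K0 _ /K0; rewrite inE.
have sub01 : below k \subset below k.+1.
  by apply/subsetP=> x; rewrite !inE => /ltnW.
case: d Pc => [|d] Pc.
  exists (fun=> 0); split=> [S T|K p q] /=.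
    by rewrite !inE => /andP[_ /eqP/cards0_eq ->] /andP[_ /eqP/cards0_eq ->].
  move=> _ /eqP/cards1P[a ->]; rewrite !inE => /eqP-> /eqP->.
  by rewrite ltnn.
pose t : 'I_n := Ordinal kn.
have [f0 [f0i f0P]] : exists f, ranks_on (below k) d.+1 P f.
  apply: IH => [|K x y z KX]; first exact: ltnW.
  by apply: Pc; apply: subset_trans KX sub01.
have tNk K : K \subset below k -> t \notin K.
  by move=> /subsetP KX; apply/negP => /KX; rewrite inE /= ltnn.
have lt_t (x : 'I_n) K : K \subset below k -> x \in K -> x < t.
  by move=> /subsetP KX /KX; rewrite inE.
have ltt_ne (x : 'I_n) : x < t -> t != x.
  by rewrite -val_eqE /=; lia.
have tU K : K \subset below k -> (t |: K) \subset below k.+1.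
  move=> KX; rewrite subUset (subset_trans KX sub01) andbT.
  by rewrite sub1set inE /=.
have [f1 [f1i f1P]] : exists f, ranks_on (below k) d [pred T : {set 'I_n} | P (t |: T)] f.
  apply: IH => [|K x y z KX cK xK yK zK xy yz]; first exact: ltnW.
  rewrite /= -!setU1D1; try exact/ltt_ne/(lt_t _ K).
  apply: Pc => //; rewrite ?inE ?xK ?yK ?zK ?orbT //; first exact: tU.
  by rewrite cardsU1 tNk // cK.
(* M0 and M1 exceed all ranks, so the three groups of f do not overlap. *)
pose M0 := (\max_(T : {set 'I_n}) f0 T).+1.
pose M1 := (\max_(T : {set 'I_n}) f1 T).+1.
have f0M T : f0 T < M0 by rewrite ltnS; exact: leq_bigmax.
have f1M T : f1 T < M1 by rewrite ltnS; exact: leq_bigmax.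
pose f T := if t \in T then M0 + f1 (T :\ t) else
  if P (t |: T) then M0 + M1 + f0 T else f0 T.
have down T : T \subset below k.+1 -> t \notin T -> T \subset below k.
  move=> /subsetP TX tT; apply/subsetP=> x xT; have := TX _ xT.
  rewrite !inE ltnS leq_eqVlt => /orP[/eqP xk|//].
  by case/negP: tT; rewrite (_ : t = x) //; apply: val_inj.
have downD T : T \subset below k.+1 -> T :\ t \subset below k.
  move=> TX; apply: down; last by rewrite !inE eqxx.
  exact: subset_trans (subD1set _ _) TX.
exists f; split=> [S T|K p q KX cK pK qK pq].
  rewrite !inE => /andP[SX /eqP cS] /andP[TX /eqP cT]; rewrite /f.
  have [tS|tS] := boolP (t \in S); have [tT|tT] := boolP (t \in T).
  - move/addnI => E; rewrite -(setD1K tS) -(setD1K tT); congr (_ |: _).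
    apply: f1i => //; rewrite !inE downD //=; apply/eqP; exact: cardD1_in.
  - by have := f0M T; have := f1M (S :\ t); case: ifP => _; clear; lia.
  - by have := f0M S; have := f1M (T :\ t); case: ifP => _; clear; lia.
  - have := f0M S; have := f0M T.
    have H : f0 S = f0 T -> S = T.
      by move=> E; apply: f0i; rewrite ?inE ?down //=; apply/eqP.
    by do 2!case: ifP => _; try (clear; lia); move=> _ _; [move/addnI|]; exact: H.
have pq_ne : (p == q) = false by apply/eqP => E; move: pq; rewrite E ltnn.
have [tK|tK] := boolP (t \in K); last first.
  have KX' := down _ KX tK.
  rewrite /f !inE !(negPf tK) !andbF.
  have pt := lt_t _ _ KX' pK; have qt := lt_t _ _ KX' qK.
  have cU : #|t |: K| = d.+3 by rewrite cardsU1 tK cK.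
  have := @Pc (t |: K) p q t (tU _ KX') cU.
  rewrite !inE eqxx pK qK !orbT => /(_ isT isT isT pq qt).
  rewrite setU1K // !setU1D1 ?ltt_ne // (f0P K p q) //.
  have := f0M (K :\ p); have := f0M (K :\ q).
  by do 2!case: ifP => _; clear; lia.
have [qt|qt] := eqVneq q t; last first.
  have qk : q < t.
    have /subsetP/(_ q qK) := KX; rewrite inE ltnS leq_eqVlt => /orP[/eqP E|//].
    by case/eqP: qt; apply: val_inj.
  have pk := ltn_trans pq qk.
  rewrite /f !inE !ltt_ne // !tK /= ltn_add2l (setD1_swap _ p) (setD1_swap _ q).
  rewrite -(f1P (K :\ t) p q) //=; first by rewrite setD1K.
  - exact: downD.
  - exact: cardD1_in.
  - by rewrite !inE eq_sym ltt_ne.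
  - by rewrite !inE eq_sym ltt_ne.
rewrite qt in pq pq_ne qK *.
rewrite /f !inE eqxx /= tK andbT eq_sym pq_ne /= setD1K //.
have := f0M (K :\ t); have := f1M (K :\ p :\ t).
by case: (P K); clear; lia.
Qed.

Lemma consistent_ranks d P :
  consistent_on setT d P -> exists f, ranks_on setT d P f.
Proof.
have -> : setT = below n by apply/setP=> x; rewrite !inE ltn_ord.
exact: consistent_ranks_below.
Qed.

Lemma pairwise_sorted_rel (T : eqType) (e R : rel T) (s : seq T) :
    transitive e -> irreflexive e -> sorted e s ->
  pairwise R s <-> {in s &, forall x y, e x y -> R x y}.
Proof.
move=> et ei; elim: s => [|a s IH] // es.
have ea : all (e a) s by apply: order_path_min.
have {}IH := IH (path_sorted es).
rewrite /=; split=> [/andP[/allP Ra /IH Rs] x y|H].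
  rewrite !inE => /predU1P[->|xs] /predU1P[->|ys]; first by rewrite ei.
  - by move=> _; apply: Ra.
  - by move=> xa; have := et _ _ _ xa (allP ea _ xs); rewrite ei.
  - exact: Rs.
apply/andP; split.
  by apply/allP=> y ys; apply: H; rewrite ?inE ?eqxx ?ys ?orbT //; apply: (allP ea).
by apply/IH => x y xs ys; apply: H; rewrite inE ?xs ?ys orbT.
Qed.

Lemma enum_set_sorted K : sorted (fun x y : 'I_n => x < y) (enum K).
Proof.
rewrite {1}/enum_mem -enumT; apply: sorted_filter.
  by move=> x y z; exact: ltn_trans.
by have := iota_ltn_sorted 0 n; rewrite -val_enum_ord sorted_map enumT.
Qed.

Section Order.
Variables (d : nat) (r : rel {set 'I_n}).
Hypothesis r_lin : linear_order_on (ksubsets n d) r.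

Lemma packet_ksubsets K : K \in ksubsets n d.+1 ->
  all (mem (ksubsets n d)) (packet K).
Proof.
rewrite inE => /eqP cK; apply/allP => T /mapP[x].
by rewrite mem_rev mem_enum => xK -> /=; rewrite in_set (cardD1_in xK cK).
Qed.

Lemma lexicographicalP K : K \in ksubsets n d.+1 ->
  lexicographical r K <->
  forall p q : 'I_n, p \in K -> q \in K -> p < q -> r (K :\ q) (K :\ p).
Proof.
case: r_lin => _ rt _ KK; rewrite /lexicographical.
rewrite (sorted_pairwise_in rt (packet_ksubsets KK)) /packet pairwise_map.
rewrite (@pairwise_sorted_rel _ (fun x y : 'I_n => y < x)); first last.
- by rewrite rev_sorted enum_set_sorted.
- by move=> x; rewrite ltnn.
- by move=> x y z yx xz; exact: ltn_trans xz yx.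
split=> H p q pK qK pq.
  by apply: H => //; rewrite mem_rev mem_enum.
by move: pK qK; rewrite !mem_rev !mem_enum => pK qK; exact: H.
Qed.

Lemma antilexicographicalP K : K \in ksubsets n d.+1 ->
  antilexicographical r K <->
  forall p q : 'I_n, p \in K -> q \in K -> p < q -> r (K :\ p) (K :\ q).
Proof.
case: r_lin => _ rt _ KK; rewrite /antilexicographical.
rewrite (sorted_pairwise_in rt) ?all_rev ?packet_ksubsets //.
rewrite /packet -map_rev revK pairwise_map.
rewrite (@pairwise_sorted_rel _ (fun x y : 'I_n => x < y)); first last.
- exact: enum_set_sorted.
- by move=> x; rewrite ltnn.
- by move=> x y z; exact: ltn_trans.
split=> H p q pK qK pq.
  by apply: H => //; rewrite mem_enum.
by move: pK qK; rewrite !mem_enum => pK qK; exact: H.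
Qed.

End Order.

(** For d = 0 a packet is a single set and every singleton counts as inverted,
    so positivity of d is needed to recover b from the rank. *)
Lemma higher_bruhat_ranksP d b : 0 < d ->
  higher_bruhat d b <->
  b \subset ksubsets n d.+1 /\ exists f, ranks_on setT d (mem b) f.
Proof.
move=> d0; split=> [[r [r_lin r_pack] <-]|[bK [f [fi fP]]]].
  split; first by apply/subsetP=> K; rewrite inE => /andP[].
  case: (r_lin) => ra rt rtot.
  pose f T := #|[set S in ksubsets n d | r S T]|.
  have rr T : T \in ksubsets n d -> r T T.
    by move=> TK; have := rtot _ _ TK TK; rewrite orbb.
  have f_le S T : S \in ksubsets n d -> T \in ksubsets n d ->
      (f S <= f T) = r S T.
    have f_mono U V : U \in ksubsets n d -> V \in ksubsets n d -> r U V ->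
        [set S in ksubsets n d | r S U] \subset [set S in ksubsets n d | r S V].
      move=> UK VK UV; apply/subsetP=> W; rewrite !in_set => /andP[WK WU].
      by apply/andP; split=> //; apply: (rt U) => //; rewrite inE.
    move=> SK TK; apply/idP/idP=> [fST|rST]; last exact/subset_leq_card/f_mono.
    case/orP: (rtot _ _ SK TK) => // rTS.
    have /eqP E : [set S' in ksubsets n d | r S' T] == [set S' in ksubsets n d | r S' S].
      by rewrite eqEcard f_mono.
    have : S \in [set S' in ksubsets n d | r S' S] by rewrite in_set SK rr.
    by rewrite -E in_set SK.
  exists f; split=> [S T|K p q _ cK pK qK pq].
    rewrite !inE !subsetT /= => cS cT E.
    by apply: ra; rewrite ?inE // -!f_le ?inE // E leqnn.
  have KK : K \in ksubsets n d.+1 by rewrite inE; apply/eqP.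
  have [pD qD] : K :\ p \in ksubsets n d /\ K :\ q \in ksubsets n d.
    by rewrite !inE; split; apply/eqP/cardD1_in.
  have rqp : r (K :\ q) (K :\ p) = ~~ (f (K :\ p) < f (K :\ q)).
    by rewrite -leqNgt f_le.
  have -> : (mem (inversions d r)) K = antilexicographical r K.
    by rewrite /= in_set KK.
  apply/idP/idP => [/(antilexicographicalP r_lin KK) H|lt_f].
    rewrite ltnNge f_le //; apply/negP=> rqp'.
    have E : K :\ p = K :\ q by apply: ra => //; rewrite rqp' H.
    by case/eqP: (ord_ltn_neq pq); exact: setD1_inj E.
  case/orP: (r_pack _ KK) => // /(lexicographicalP r_lin KK) H.
  by have := H _ _ pK qK pq; rewrite rqp lt_f.
pose r := [rel S T | f S <= f T].
have r_lin : linear_order_on (ksubsets n d) r.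
  split=> [S T|S T U|S T] /=.
  - rewrite !in_set => cS cT E; apply: fi; rewrite ?inE ?subsetT //.
    by apply/eqP; rewrite eqn_leq.
  - by move=> _ _ _; exact: leq_trans.
  - by move=> _ _; exact: leq_total.
have bE K : K \in ksubsets n d.+1 -> K \in b ->
    antilexicographical r K.
  move=> KK Kb; apply/(antilexicographicalP r_lin KK) => p q pK qK pq.
  rewrite inE in KK; rewrite /r /= ltnW // -(fP K p q) ?subsetT //.
  exact/eqP.
exists r; first split=> //.
  move=> K KK; apply/orP; have [Kb|Kb] := boolP (K \in b); [right; exact: bE|left].
  apply/(lexicographicalP r_lin KK) => p q pK qK pq.
  rewrite inE in KK; rewrite /r /= leqNgt -(fP K p q) ?subsetT //.
  exact/eqP.
apply/setP=> K; rewrite in_set.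
have [KK|/=] := boolP (K \in ksubsets n d.+1); last first.
  by move=> KK; apply/esym/negP => /(subsetP bK); apply/negP.
apply/idP/idP=> [/= /(antilexicographicalP r_lin KK) H|]; last exact: bE.
apply: contraT => Kb.
have /eqP cK : #|K| == d.+1 by rewrite inE in KK.
have : 1 < #|K| by rewrite cK.
case/card_gt1P => x [y [xK yK xy]].
have {x y xK yK xy} [p [q [pK qK pq]]] : exists p q, [/\ p \in K, q \in K & p < q].
  move: xy; rewrite -val_eqE /= neq_ltn => /orP[] lt; [by exists x, y|by exists y, x].
have nlt : (f (K :\ p) < f (K :\ q)) = false.
  by rewrite -(fP K p q) ?subsetT //; exact: negbTE.
have /= := H _ _ pK qK pq; rewrite leq_eqVlt nlt orbF => /eqP E.
have E' : K :\ p = K :\ q.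
  by apply: fi => //; rewrite inE subsetT; apply/eqP/cardD1_in.
by case/eqP: (ord_ltn_neq pq); exact: setD1_inj E'.
Qed.

(** Ziegler's criterion; both implications go through the rank of an admissible
    order. *)
Lemma higher_bruhatP d b : 0 < d ->
  higher_bruhat d b <->
  b \subset ksubsets n d.+1 /\ consistent_on setT d (mem b).
Proof.
move=> d0; rewrite higher_bruhat_ranksP //; split=> -[bK].
  by move=> [f /ranks_consistent].
by move/consistent_ranks.
Qed.

End Consistency.

(** * Chains of flips given by a rank function *)

Section Chains.

Variables n d : nat.
Implicit Types (I S : {set {set 'I_n}}) (K L : {set 'I_n}).
Implicit Types (f : {set 'I_n} -> nat).

Lemma flip_le_trans I1 I2 I3 :
  flip_le d I1 I2 -> flip_le d I2 I3 -> flip_le d I1 I3.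
Proof. by move=> [h1 s12] [_ s23]; split=> //; apply: rt_trans s12 s23. Qed.

Lemma flip_le_ranked I S f :
    S \subset ksubsets n d.+1 -> [disjoint I & S] -> {in S &, injective f} ->
    (forall k, higher_bruhat d (I :|: [set L in S | f L < k])) ->
  flip_le d I (I :|: S).
Proof.
move=> SK dis fi hb.
have S0 : I :|: [set L in S | f L < 0] = I.
  by apply/setP=> L; rewrite !inE ltn0 andbF orbF.
have chain k : clos_refl_trans _ (@increasing_flip n d) I
    (I :|: [set L in S | f L < k]).
  elim: k => [|k IH]; first by rewrite S0; exact: rt_refl.
  apply: rt_trans IH _.
  have [/existsP[L /andP[LS /eqP fL]]|noL] := boolP [exists L, (L \in S) && (f L == k)].
    apply: rt_step; split=> //; exists L.
      rewrite in_setD (subsetP SK) // andbT !inE LS fL ltnn orbF.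
      by move: dis; rewrite disjoint_sym => /disjointFr ->.
    apply/setP=> L'; rewrite !inE ltnS leq_eqVlt orbCA; congr (_ || _).
    rewrite andb_orr; congr (_ || _); apply/andP/eqP => [[L'S /eqP fL']|->].
      by apply: fi; rewrite ?fL.
    by rewrite LS fL.
  suff -> : [set L in S | f L < k.+1] = [set L in S | f L < k] by exact: rt_refl.
  apply/setP=> L; rewrite !inE; case: (boolP (L \in S)) => //= LS.
  rewrite ltnS leq_eqVlt; case: eqP => // fL.
  by case/existsP: noL; exists L; rewrite LS fL eqxx.
split; first by rewrite -[I]S0.
have -> : S = [set L in S | f L < (\max_(L' : {set 'I_n}) f L').+1].
  by apply/setP=> L; rewrite inE ltnS leq_bigmax andbT.
exact: chain.
Qed.

(** In [fS], w is a witness of the side from which the packet is filled.  If w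
    is right of q and K \ w is in I, the packet is met by I in an initial
    segment, which must grow towards smaller removed elements, so K \ q comes
    first; each of the two changes, w left of p or K \ w outside I, reverses
    this. *)
Section Interpolate.
Variables (I S : {set {set 'I_n}}) (f : {set 'I_n} -> nat).
Hypotheses (dis : [disjoint I & S])
  (I_cons : consistent_on setT d (mem I))
  (IS_cons : consistent_on setT d (mem (I :|: S)))
  (fS : forall K (p q : 'I_n), #|K| = d.+2 -> p \in K -> q \in K -> p < q ->
     K :\ p \in S -> K :\ q \in S ->
     (exists2 w, w \in K & K :\ w \notin S) /\
     forall w : 'I_n, w \in K -> K :\ w \notin S ->
       (f (K :\ p) < f (K :\ q)) = (K :\ w \in I) (+) (q < w)).

(** A triple of a packet with at most one member in S looks the same in the
    interpolating family as in I or in I :|: S.  With two members in S they are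
    neighbours in the triple, since a member of neither family or of both
    between them would contradict one of the two consistencies; the hypothesis
    on f then says that they are added in the right order.  With three members
    in S the same hypothesis, applied with a fourth element w, shows that f is
    monotone along the triple. *)
Lemma consistent_interpolate k :
  consistent_on setT d (mem (I :|: [set L in S | f L < k])).
Proof.
have SNI L : L \in S -> (L \in I) = false.
  by move: dis; rewrite disjoint_sym => /disjointFr; apply.
have tri K (x y z : 'I_n) : #|K| = d.+2 -> x \in K -> y \in K -> z \in K ->
    x < y -> y < z ->
    ((K :\ x \in I) = (K :\ z \in I) -> (K :\ y \in I) = (K :\ x \in I)) /\
    ((K :\ x \in I) || (K :\ x \in S) = (K :\ z \in I) || (K :\ z \in S) ->
     (K :\ y \in I) || (K :\ y \in S) = (K :\ x \in I) || (K :\ x \in S)).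
  move=> cK xK yK zK xy yz; split.
    by have := I_cons (subsetT K) cK xK yK zK xy yz; rewrite !inE.
  by have := IS_cons (subsetT K) cK xK yK zK xy yz; rewrite /= !in_setU.
have convex K (x y z : 'I_n) : #|K| = d.+2 -> x \in K -> y \in K -> z \in K ->
    x < y -> y < z -> K :\ x \in S -> K :\ z \in S -> K :\ y \in S.
  move=> cK xK yK zK xy yz xS zS.
  have [] := tri K x y z cK xK yK zK xy yz.
  rewrite (SNI _ xS) (SNI _ zS) xS zS /= => /(_ erefl) -> /(_ erefl).
  by [].
move=> K x y z _ cK xK yK zK xy yz.
have [T0 T1] := tri K x y z cK xK yK zK xy yz.
have xz := ltn_trans xy yz.
rewrite /= !in_setU !inE.
have [xS|xS] := boolP (K :\ x \in S); have [yS|yS] := boolP (K :\ y \in S);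
  have [zS|zS] := boolP (K :\ z \in S); rewrite ?(SNI _ xS) ?(SNI _ yS) ?(SNI _ zS) /=
  ?orbF; move: T0 T1; rewrite ?xS ?yS ?zS ?(negPf xS) ?(negPf yS) ?(negPf zS)
    ?(SNI _ xS) ?(SNI _ yS) ?(SNI _ zS) ?orbF ?orbT //= => T0 T1.
- have [[w wK wS] fxy] := fS cK xK yK xy xS yS.
  have [_ fyz] := fS cK yK zK yz yS zS.
  move: (fxy w wK wS) (fyz w wK wS).
  have -> : (y < w) = (z < w).
    have [zw|wz] := ltnP z w; first exact: ltn_trans zw.
    apply/negP=> yw; case/negP: wS.
    move: wz; rewrite leq_eqVlt => /orP[/eqP/val_inj->//|wz].
    exact: convex xK wK zK (ltn_trans xy yw) wz xS zS.
  by case: (_ (+) _); clear; lia.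
- have [_ /(_ z zK zS)] := fS cK xK yK xy xS yS.
  by rewrite yz addbT; case: (K :\ z \in I) => /=; clear; lia.
- by move: (T1 erefl); rewrite (T0 erefl).
- by case: (_ < k).
- have [_ /(_ x xK xS)] := fS cK yK zK yz yS zS.
  by rewrite (ltnNge z) (ltnW xz) addbF; case: (K :\ x \in I) => /=; clear; lia.
- by case: (_ < k).
- by case: (_ < k).
Qed.

End Interpolate.

Lemma flip_le_by_rank I S f : 0 < d ->
    I \subset ksubsets n d.+1 -> S \subset ksubsets n d.+1 ->
    [disjoint I & S] -> {in S &, injective f} ->
    consistent_on setT d (mem I) -> consistent_on setT d (mem (I :|: S)) ->
    (forall K (p q : 'I_n), #|K| = d.+2 -> p \in K -> q \in K -> p < q ->
      K :\ p \in S -> K :\ q \in S ->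
      (exists2 w, w \in K & K :\ w \notin S) /\
      forall w : 'I_n, w \in K -> K :\ w \notin S ->
        (f (K :\ p) < f (K :\ q)) = (K :\ w \in I) (+) (q < w)) ->
  flip_le d I (I :|: S).
Proof.
move=> d0 IK SK dis fi cI cIS fS; apply: flip_le_ranked fi _ => // k.
apply/higher_bruhatP => //; split; last exact: consistent_interpolate.
rewrite subUset IK; apply: subset_trans SK; apply/subsetP=> L.
by rewrite inE => /andP[].
Qed.

End Chains.

(** * Increasing maps and intervals *)

Lemma consistent_on_eq n (X : {set 'I_n}) d (P Q : pred {set 'I_n}) :
  (forall L : {set 'I_n}, #|L| = d.+1 -> P L = Q L) ->
  consistent_on X d P -> consistent_on X d Q.
Proof.
move=> PQ Pc K x y z KX cK xK yK zK xy yz.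
by rewrite -!PQ; [exact: Pc| | |]; exact: cardD1_in cK.
Qed.

Section Pullback.

Variables (k N : nat) (g : 'I_k -> 'I_N).
Hypothesis g_mono : forall x y, (g x < g y) = (x < y).

Lemma ltn_mono_inj : injective g.
Proof.
move=> x y E; apply/val_inj/eqP; rewrite eqn_leq leqNgt -g_mono E ltnn.
by rewrite leqNgt -g_mono E ltnn.
Qed.

Lemma imset_preimset (L : {set 'I_N}) :
  L \subset g @: setT -> g @: (g @^-1: L) = L.
Proof.
move=> /subsetP LY; apply/setP=> x; apply/imsetP/idP => [[y]|xL].
  by rewrite inE => yL ->.
by case/imsetP: (LY _ xL) => y _ E; exists y; rewrite // inE -E.
Qed.

Lemma preimset_imset (S : {set 'I_k}) : g @^-1: (g @: S) = S.
Proof. by apply/setP=> x; rewrite inE mem_imset //; exact: ltn_mono_inj. Qed.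

Lemma card_preimset_mono (L : {set 'I_N}) :
  L \subset g @: setT -> #|g @^-1: L| = #|L|.
Proof.
by move=> LY; rewrite -{2}(imset_preimset LY) card_imset //; exact: ltn_mono_inj.
Qed.

Lemma preimsetD1 (L : {set 'I_N}) x : g @^-1: (L :\ g x) = (g @^-1: L) :\ x.
Proof. by apply/setP=> y; rewrite !inE (inj_eq ltn_mono_inj). Qed.

Lemma consistent_pull d (b : {set {set 'I_k}}) :
  consistent_on setT d (mem b) ->
  consistent_on (g @: setT) d (fun L => g @^-1: L \in b).
Proof.
move=> bc K x y z KY cK xK yK zK.
case/imsetP: (subsetP KY _ xK) => x' _ Ex; case/imsetP: (subsetP KY _ yK) => y' _ Ey.
case/imsetP: (subsetP KY _ zK) => z' _ Ez.
rewrite Ex Ey Ez in xK yK zK *; rewrite !g_mono => xy yz.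
rewrite /= !preimsetD1; apply: bc; rewrite ?inE ?subsetT //.
by rewrite card_preimset_mono.
Qed.

Lemma ranks_pull d (b : {set {set 'I_k}}) f :
  ranks_on setT d (mem b) f ->
  ranks_on (g @: setT) d (fun L => g @^-1: L \in b) (fun L => f (g @^-1: L)).
Proof.
move=> [fi fP]; split=> [S T|K p q KY cK pK qK].
  rewrite !inE => /andP[SY cS] /andP[TY cT] E.
  rewrite -(imset_preimset SY) -(imset_preimset TY).
  suff -> : g @^-1: S = g @^-1: T by [].
  by apply: fi; rewrite ?inE ?subsetT ?card_preimset_mono.
case/imsetP: (subsetP KY _ pK) => p' _ Ep; case/imsetP: (subsetP KY _ qK) => q' _ Eq.
rewrite Ep Eq in pK qK *; rewrite g_mono => pq.
rewrite /= !preimsetD1; apply: (fP (g @^-1: K)); rewrite ?inE ?subsetT //.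
by rewrite card_preimset_mono.
Qed.

End Pullback.

Lemma card_interval N a b : b <= N -> #|[set x : 'I_N | a <= x < b]| = b - a.
Proof.
move=> bN; rewrite cardsE cardE size_filter -enumT.
have -> : count (fun x : 'I_N => a <= x < b) (enum 'I_N) =
          count (fun x => a <= x < b) (iota 0 N).
  by rewrite -val_enum_ord count_map.
have [ba|ab] := leqP b a.
  rewrite (eqP (_ : b - a == 0)) ?subn_eq0 // (@eq_count _ _ pred0) ?count_pred0 //.
  by move=> x /=; lia.
have -> : N = a + ((b - a) + (N - b)) by lia.
rewrite !iotaD !count_cat.
rewrite (@eq_in_count _ _ pred0 (iota 0 a)); last by move=> x; rewrite mem_iota /=; lia.
rewrite (@eq_in_count _ _ predT (iota (0 + a) (b - a))); last first.
  by move=> x; rewrite mem_iota /=; lia.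
rewrite (@eq_in_count _ _ pred0 (iota _ (N - b))); last by move=> x; rewrite mem_iota /=; lia.
by rewrite !count_pred0 count_predT size_iota; lia.
Qed.

(** The list of S is sorted, so its elements from p on form a tail of length k. *)
Lemma rightmost_threshold N (S : {set 'I_N}) k p :
  #|[set x in S | p <= x]| = k -> rightmost k S = [set x in S | p <= x].
Proof.
move=> cS.
have split_sorted (s : seq 'I_N) : sorted (fun x y : 'I_N => x < y) s ->
    s = [seq x : 'I_N <- s | x < p] ++ [seq x : 'I_N <- s | p <= x].
  elim: s => [|a s IH] //= es.
  have as_ : all (fun x : 'I_N => a < x) s.
    by apply: order_path_min es => x y z; exact: ltn_trans.
  have [ap|pa] := ltnP a p; first by rewrite /= -IH //; exact: path_sorted es.
  have -> : [seq x : 'I_N <- s | x < p] = [::].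
    apply/eqP; rewrite -(negbK (_ == _)) -has_filter; apply/hasPn=> x xs.
    by have := allP as_ _ xs; lia.
  have -> // : [seq x : 'I_N <- s | p <= x] = s.
  by apply/all_filterP/allP=> x xs; have := allP as_ _ xs; lia.
have E : [set x in S | p <= x] =i [seq x : 'I_N <- enum S | p <= x].
  by move=> x; rewrite inE mem_filter mem_enum andbC.
have sz : size [seq x : 'I_N <- enum S | p <= x] = k.
  by rewrite -cS (eq_card E) (card_uniqP _) // filter_uniq // enum_uniq.
apply/setP=> x; rewrite E inE.
have := split_sorted _ (enum_set_sorted S) => {1}->.
rewrite drop_size_cat // cardE.
have /(congr1 size) := split_sorted _ (enum_set_sorted S).
by rewrite size_cat sz => ->; rewrite addnK.
Qed.

(** * The bar operation *)

Lemma in_blockA N j (x : 'I_N) : (x \in blockA N j) = (x < j).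
Proof. by rewrite in_set. Qed.

Lemma in_blockB N m j (x : 'I_N) : (x \in blockB N m j) = (j <= x < j + m).
Proof. by rewrite in_set. Qed.

Lemma in_blockC N m j (x : 'I_N) : (x \in blockC N m j) = (j + m <= x).
Proof. by rewrite in_set. Qed.

Lemma in_blockD N d j (x : 'I_N) : (x \in blockD N d j) = (j <= x < j + d).
Proof. by rewrite in_set. Qed.

Definition in_blocks := (in_blockA, in_blockB, in_blockC, in_blockD).

Section Fill.

Variables N m d j : nat.
Hypotheses (hdm : d <= m) (hN : j + m <= N).
Implicit Types K L : {set 'I_N}.

Notation B := (blockB N m j).
Notation bar := (insertion_bar m d j).

Definition outer := blockA N j :|: blockD N d j :|: blockC N m j.

Lemma in_outer (x : 'I_N) : (x \in outer) = (x < j + d) || (j + m <= x).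
Proof. by rewrite !in_setU !in_blocks; lia. Qed.

Definition zone c : {set 'I_N} := [set x : 'I_N | j + c <= x < j + m].

Definition fill c L := [set x : 'I_N | if x \in zone c then x < j + d else x \in L].

Lemma in_zone c (x : 'I_N) : (x \in zone c) = (j + c <= x < j + m).
Proof. by rewrite in_set. Qed.

Lemma in_fill c L (x : 'I_N) :
  (x \in fill c L) = if x \in zone c then x < j + d else x \in L.
Proof. by rewrite in_set. Qed.

Lemma card_mem_D1 L x : x \in L -> #|L| = #|L :\ x|.+1.
Proof. by move=> xL; rewrite (cardsD1 x) xL. Qed.

Lemma card_setID L K : #|L| = #|L :&: K| + #|L :\: K|.
Proof. by rewrite cardsID. Qed.

Definition in_regions := (in_outer, in_blocks, in_fill, in_zone, inE).

(** Then pushing the elements of L in the zone to the right end of the first d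
    places of B fills these places exactly from j + c on. *)
Definition threshold c L := (c <= d) && (#|L :&: zone c| == d - c).

Lemma zone0 : zone 0 = B.
Proof. by apply/setP=> x; rewrite !in_regions addn0. Qed.

Lemma zoneSD c (y : 'I_N) : y = j + c :> nat -> zone c.+1 = zone c :\ y.
Proof. by move=> yc; apply/setP=> x; rewrite !in_regions -val_eqE /= yc; lia. Qed.

(** The number of elements of L in the zone plus c increases by at most one with
    c, from at most d at c = 0, so it equals d at the last c where it is at most
    d.  If that c is below d, then j + c is not in L, since otherwise the value at
    c + 1 would be the same. *)
Lemma max_threshold L : #|L :&: B| <= d ->
  exists2 c, threshold c L & c < d -> forall x : 'I_N, x \in L -> x != j + c :> nat.
Proof.
rewrite -zone0 => c0.
pose Q c := (c <= d) && (#|L :&: zone c| + c <= d).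
have exQ : exists c, Q c by exists 0; rewrite /Q addn0.
have boundQ c : Q c -> c <= d by case/andP.
case: (ex_maxnP exQ boundQ) => c /andP[cd Qc] maxc.
exists c.
  rewrite /threshold cd andTb eqn_leq; apply/andP; split; first lia.
  have [cd'|] := ltnP c d; last by lia.
  have := maxc c.+1; rewrite /Q cd' ltnn andTb => /contraFN.
  move/(_ erefl); rewrite -ltnNge => H.
  have : #|L :&: zone c.+1| <= #|L :&: zone c|.
    by apply/subset_leq_card/setIS/subsetP=> x; rewrite !in_regions; lia.
  by lia.
move=> cd' x xL; apply/negP => /eqP xc.
have := maxc c.+1; rewrite /Q cd' ltnn andTb => /contraFN.
move/(_ erefl); rewrite -ltnNge.
have xz : x \in L :&: zone c by rewrite !in_regions xL; lia.
have : #|L :&: zone c| = #|L :&: zone c.+1|.+1.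
  by rewrite (card_mem_D1 xz) (zoneSD xc) setIDA.
by lia.
Qed.

Lemma card_setD_subset L (S : {set 'I_N}) : S \subset L -> #|L :\: S| = #|L| - #|S|.
Proof. by move=> SL; rewrite cardsD (setIidPr SL). Qed.

(** By the choice of c, the places of D from j + c on that are missing from L are
    as many as the elements of L in B outside D, so they are the ones that
    get filled. *)
Lemma insertion_bar_fill c L : threshold c L -> bar L = fill c L.
Proof.
case/andP=> cd /eqP cL; rewrite /insertion_bar -/outer.
set k := #|_|.
have kE : k = #|L :&: zone d|.
  by apply: eq_card => x; rewrite !in_regions; case: (x \in L) => //=; try case: ifP; lia.
rewrite (@rightmost_threshold _ _ k (j + c)).
  by apply/setP=> x; rewrite !in_regions; case: (x \in L) => //=; try case: ifP; lia.
have -> : [set x in blockD N d j :\: L :&: outer | j + c <= x]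
        = [set x : 'I_N | j + c <= x < j + d] :\: (L :&: [set x : 'I_N | j + c <= x < j + d]).
  by apply/setP=> x; rewrite !in_regions; case: (x \in L) => //=; try case: ifP; lia.
rewrite card_setD_subset ?subsetIr // card_interval; last lia.
have : #|L :&: zone c| = #|L :&: [set x : 'I_N | j + c <= x < j + d]| + k.
  rewrite kE (card_setID (L :&: zone c) (zone d)) addnC; congr (_ + _).
    by apply: eq_card => x; rewrite !in_regions; case: (x \in L) => //=; try case: ifP; lia.
  by apply: eq_card => x; rewrite !in_regions; case: (x \in L) => //=; try case: ifP; lia.
by lia.
Qed.

Lemma fill_outer c L : c <= d -> fill c L \subset outer.
Proof. by move=> cd; apply/subsetP=> x; rewrite in_outer !in_regions; case: ifP; lia. Qed.

Lemma card_fill c L : threshold c L -> #|fill c L| = #|L|.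
Proof.
case/andP=> cd /eqP cL.
rewrite (card_setID (fill c L) (zone c)) (card_setID L (zone c)) cL; congr (_ + _).
  rewrite -(_ : #|[set x : 'I_N | j + c <= x < j + d]| = d - c).
    by apply: eq_card => x; rewrite !in_regions; case: (x \in L) => //=; try case: ifP; lia.
  by rewrite card_interval; lia.
by apply: eq_card => x; rewrite !in_regions; case: ifP.
Qed.

(** The default value of [insubd] is never reached: a nonempty zone contains
    the place j + c. *)
Definition collapse c (x : 'I_N) : 'I_N :=
  if x \in zone c then insubd x (j + c) else x.

Lemma val_collapse c (x : 'I_N) :
  collapse c x = (if x \in zone c then j + c else x) :> nat.
Proof.
rewrite /collapse; case: ifP => //; rewrite in_regions => xz.
by rewrite val_insubd; case: ifP => //; have := ltn_ord x; lia.
Qed.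

Lemma collapse_leq c (x y : 'I_N) : x < y -> collapse c x <= collapse c y.
Proof. by move=> xy; rewrite !val_collapse !in_regions; do 2!case: ifP; lia. Qed.

Lemma collapse_fill c L x : threshold c L -> x \in L -> collapse c x \in fill c L.
Proof.
case/andP=> cd /eqP cL xL; rewrite in_regions inE val_collapse.
have [xz|xz] := boolP (x \in zone c); last first.
  by rewrite in_regions in xz; rewrite (negPf xz) /collapse inE (negPf xz).
have : 0 < #|L :&: zone c| by apply/card_gt0P; exists x; rewrite in_setI xL.
by move: xz; rewrite cL inE => xz; case: ifP; lia.
Qed.

(** Removing an element outside the zone keeps the threshold.  Removing one
    inside the zone lowers the count by one, and by maximality of c the place
    j + c is free, so c + 1 is a threshold of L :\ x: the place j + c is the one
    that is no longer filled. *)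
Lemma insertion_bar_D1 c L (x : 'I_N) : threshold c L ->
    (c < d -> forall y : 'I_N, y \in L -> y != j + c :> nat) -> x \in L ->
  bar (L :\ x) = fill c L :\ collapse c x.
Proof.
move=> thr; case/andP: (thr) => cd /eqP cL maxc xL.
have [xz|xz] := boolP (x \in zone c); last first.
  have thr' : threshold c (L :\ x).
    rewrite /threshold cd -cL /=; apply/eqP/eq_card=> y; rewrite !in_regions.
    by case: (y =P x) => // ->; move: xz; rewrite in_regions => /negPf->; rewrite !andbF.
  rewrite (insertion_bar_fill thr') /collapse (negPf xz).
  apply/setP=> y; rewrite !in_regions; case: (y =P x) => // ->.
  by move: xz; rewrite in_regions => /negPf->.
have xLz : x \in L :&: zone c by rewrite in_setI xL.
have cd' : c < d by move: cL; rewrite (card_mem_D1 xLz); lia.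
have {}maxc := maxc cd'.
pose y := collapse c x; have yc : y = j + c :> nat by rewrite val_collapse xz.
have thr' : threshold c.+1 (L :\ x).
  rewrite /threshold cd' andTb (zoneSD yc); apply/eqP.
  have cz : #|L :&: zone c| = #|(L :&: zone c) :\ x|.+1 by exact: card_mem_D1.
  have <- : #|(L :&: zone c) :\ x| = d - c.+1 by lia.
  apply: eq_card => z; rewrite !in_regions.
  have [zy|_] := eqVneq z y; last by rewrite /= -andbA.
  have /negbTE -> : z \notin L.
    by apply/negP=> /maxc; rewrite zy yc eqxx.
  by rewrite !andbF.
rewrite (insertion_bar_fill thr') -/y.
apply/setP=> z; rewrite in_setD1 !in_fill (zoneSD yc) !in_setD1.
have [->|zy] := eqVneq z y.
  by apply/negbTE/negP=> /andP[_ /maxc]; rewrite yc eqxx.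
rewrite /=; case: ifP => // zz; case: eqP => // zx.
by move: zz; rewrite zx xz.
Qed.

Lemma packet_wide K : #|K| = d.+2 -> 1 < #|K :\: B| ->
  exists c, [/\ fill c K \subset outer, #|fill c K| = d.+2,
    threshold c K, c < d -> forall y : 'I_N, y \in K -> y != j + c :> nat &
    forall x, x \in K -> ~~ (K :\ x \subset B) /\
      bar (K :\ x) = fill c K :\ collapse c x].
Proof.
move=> cK wide; have := card_setID K B; rewrite cK => cKB.
have [|c thr maxc] := @max_threshold K; first lia.
exists c; split=> //.
- by apply: fill_outer; case/andP: thr.
- by rewrite card_fill.
move=> x xK; split; last exact: insertion_bar_D1.
apply/negP=> /subsetP KB; move: wide; apply/negP; rewrite -leqNgt -(cards1 x).
apply/subset_leq_card/subsetP=> y; rewrite !in_setD in_set1 => /andP[yB yK].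
by apply: contraR yB => yx; apply: KB; rewrite !in_regions yx.
Qed.

Lemma bar_outer L : #|L| = d.+1 -> ~~ (L \subset B) -> bar L \subset outer.
Proof.
move=> cL; rewrite -setD_eq0 -card_gt0 => LB.
have := card_setID L B; rewrite cL => cLB.
have [|c thr _] := @max_threshold L; first by move: LB cLB; clear; lia.
by rewrite (insertion_bar_fill thr) fill_outer //; case/andP: thr.
Qed.

Lemma bar_narrow L v : #|L| = d.+1 -> L :\: B = [set v] ->
  bar L = v |: blockD N d j.
Proof.
move=> cL LB; have := card_setID L B; rewrite cL LB cards1 addn1 => -[/esym cLB].
have vLB : v \in L :\: B by rewrite LB set11.
have thr : threshold 0 L by rewrite /threshold zone0 cLB subn0 eqxx.
rewrite (insertion_bar_fill thr); apply/setP=> x.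
have /setP/(_ x) := LB.
move: vLB; rewrite !in_regions addn0.
by case: (eqVneq x v) => [->|_]; case: (v \in L); case: ifP => //=; try case: (x \in L); lia.
Qed.

End Fill.

(** * Gluing an outer and an inner family *)

Lemma orient_rank (T : finType) (e : bool) (f : T -> nat) :
  exists f' : T -> nat, forall s t, (f' s < f' t) = (if e then f t < f s else f s < f t).
Proof.
case: e; last by exists f.
exists (fun t => \max_(s : T) f s - f t) => s t.
by have := @leq_bigmax T f s; have := @leq_bigmax T f t; lia.
Qed.

Section Glue.

Variables N m d j : nat.
Hypotheses (hdm : d <= m) (hN : j + m <= N).
Implicit Types (K L F : {set 'I_N}) (P : pred {set 'I_N}).

Notation B := (blockB N m j).
Notation D := (blockD N d j).
Notation bar := (insertion_bar m d j).
Notation outer := (outer N m d j).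

(** The two clauses of [insertion] for a set L that is not inside B are merged,
    since bar L = L when L avoids the part of B outside D. *)
Definition glue P P' : pred {set 'I_N} :=
  fun L => if L \subset B then P' L else P (bar L).

(** With two or more points of K outside B, the packet of K is a weakly
    increasing relabelling of the packet of bar K.  With exactly one such point
    v, all members of the packet other than K \ v agree, and v comes first or
    last in K, so it is not the middle of a triple. *)
Lemma glue_consistent P P' : consistent_on outer d P -> consistent_on B d P' ->
  consistent_on setT d (glue P P').
Proof.
move=> Pc P'c K x y z _ cK xK yK zK xy yz.
have [wide|] := ltnP 1 #|K :\: B|.
  have [c [FX cF thr maxc barK]] := packet_wide hdm hN cK wide.
  rewrite /glue; have [/negPf-> ->] := barK x xK; have [/negPf-> ->] := barK y yK.
  have [/negPf-> ->] := barK z zK.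
  have sxF := collapse_fill hdm hN thr xK; have syF := collapse_fill hdm hN thr yK.
  have szF := collapse_fill hdm hN thr zK.
  have := collapse_leq hdm hN c xy; rewrite leq_eqVlt => /orP[/eqP/val_inj->//|sxy].
  have := collapse_leq hdm hN c yz; rewrite leq_eqVlt => /orP[/eqP/val_inj->//|syz].
  exact: Pc.
rewrite leq_eqVlt ltnS leqn0 => /orP[/cards1P[v KB]|]; last first.
  rewrite cards_eq0 setD_eq0 => KB.
  have sub u : K :\ u \subset B by apply: subset_trans (subD1set _ _) KB.
  by rewrite /glue !sub; apply: P'c.
have vKB : v \in K :\: B by rewrite KB set11.
have const u : u \in K -> u != v -> glue P P' (K :\ u) = P (v |: D).
  move=> uK uv; rewrite /glue.
  have uB : (K :\ u) :\: B = [set v].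
    apply/setP=> w; have /setP/(_ w) := KB; rewrite !in_setD !in_set1.
    by have [->|_] := eqVneq w u; rewrite ?(negPf uv) ?andbF.
  have /negPf -> : ~~ (K :\ u \subset B).
    by rewrite -setD_eq0 uB; apply/set0Pn; exists v; rewrite set11.
  by rewrite (bar_narrow hdm hN _ uB) //; exact: cardD1_in uK cK.
have yv : y != v.
  apply/eqP=> yv; have /setP KB' := KB.
  have := KB' x; have := KB' z; have := vKB.
  rewrite !in_setD !in_set1 xK zK !andbT -yv !in_blockB.
  rewrite -[z == y]val_eqE -[x == y]val_eqE /=; move: xy yz.
  by case: (y \in K) => //=; lia.
have [xv|xv] := eqVneq x v; last by rewrite (const x) // (const y).
have zv : z != v by rewrite -xv eq_sym; apply: ord_ltn_neq; exact: ltn_trans yz.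
by rewrite (const z) // (const y).
Qed.

Lemma mem_bar_out L (x : 'I_N) : x \notin B -> (x \in bar L) = (x \in L).
Proof.
move=> xB; rewrite /insertion_bar -/outer in_setU in_setI.
have -> : x \in outer by move: xB; rewrite (in_outer hdm hN) in_blockB; lia.
rewrite andbT; set R := rightmost _ _; suff /negPf -> : x \notin R by rewrite orbF.
apply: contra xB; rewrite in_set => /mem_drop; rewrite mem_enum in_setD.
by case/andP=> _; rewrite !in_blocks; lia.
Qed.

Section Flip.

Variables (P P' : pred {set 'I_N}) (F0 : {set 'I_N}) (g : {set 'I_N} -> nat).
Hypotheses (F0X : F0 \subset outer) (cF0 : #|F0| = d.+1) (PF0 : ~~ P F0).
Hypotheses (Pc : consistent_on outer d P)
  (PFc : consistent_on outer d (fun L => (L == F0) || P L))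
  (gP' : ranks_on B d P' g).

(** The sets that enter the glued family when F0 is added to P. *)
Definition flipped : {set {set 'I_N}} :=
  [set L : {set 'I_N} | [&& #|L| == d.+1, ~~ (L \subset B) & bar L == F0]].

(** P and P with F0 added differ on the packet of F0 + y in the member F0
    only.  Consistency of both
    forces P to be constant on each side of y, with opposite values on the two
    sides. *)
Lemma flip_side_const y v w : y \in outer -> y \notin F0 -> v \in F0 -> w \in F0 ->
  P ((y |: F0) :\ v) (+) (y < v) = P ((y |: F0) :\ w) (+) (y < w).
Proof.
move=> yX yF0.
wlog: v w / v < w => [W vF wF|].
  have [|wv|/val_inj->//] := ltngtP v w; first by move=> vw; exact: W.
  by apply/esym; exact: W.
move=> vw vF wF; set F := y |: F0.
have cF : #|F| = d.+2 by rewrite cardsU1 yF0 cF0.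
have FX : F \subset outer by rewrite subUset sub1set yX.
have [yF [vF' wF']] : y \in F /\ (v \in F /\ w \in F).
  by rewrite !in_setU1 eqxx vF wF !orbT.
have Fy : F :\ y = F0 by rewrite setU1K.
have ney u : u \in F0 -> (F :\ u == F0) = false.
  by move=> uF; apply/eqP => /setP/(_ u); rewrite in_setD1 eqxx uF.
have neq u : u \in F0 -> y != u :> nat.
  by move=> uF; apply: contra yF0 => /eqP/val_inj->.
have := neq _ vF; have := neq _ wF => yw yv.
have [vy|yv'] := ltnP v y; first have [wy|yw'] := ltnP w y.
- have := Pc FX cF vF' wF' yF vw wy; have := PFc FX cF vF' wF' yF vw wy.
  rewrite /= (ney _ vF) (ney _ wF) Fy eqxx (negPf PF0) (ltnNge y v) (ltnNge y w).
  rewrite (ltnW vy) (ltnW wy) /=.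
  by case: (P (F :\ v)); case: (P (F :\ w)) => //= H1 H2; (move: (H1 erefl) + move: (H2 erefl)).
- have yw2 : y < w by rewrite ltn_neqAle yw.
  have := Pc FX cF vF' yF wF' vy yw2; have := PFc FX cF vF' yF wF' vy yw2.
  rewrite /= (ney _ vF) (ney _ wF) Fy eqxx (negPf PF0) yw2 (ltnNge y v) (ltnW vy) /=.
  by case: (P (F :\ v)); case: (P (F :\ w)) => //= H1 H2; (move: (H1 erefl) + move: (H2 erefl)).
have yv2 : y < v by rewrite ltn_neqAle yv.
have yw2 : y < w by exact: ltn_trans vw.
have := Pc FX cF yF vF' wF' yv2 vw; have := PFc FX cF yF vF' wF' yv2 vw.
rewrite /= (ney _ vF) (ney _ wF) Fy eqxx (negPf PF0) yv2 yw2 /=.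
by case: (P (F :\ v)); case: (P (F :\ w)) => //= H1 H2; (move: (H1 erefl) + move: (H2 erefl)).
Qed.

(** The only y for which F0 + y can be bar K for a set K with two members of
    its packet in [flipped]: the collapsed zone of K starts at y. *)
Definition last_gap (y : 'I_N) :=
  [&& y \in D, y \notin F0 & [forall z in D, (y < z) ==> (z \in F0)]].

Lemma flip_side : exists e, forall y v, last_gap y -> v \in F0 ->
  P ((y |: F0) :\ v) (+) (y < v) = e.
Proof.
have [/existsP[y0 gap0]|nogap] := boolP [exists y, last_gap y]; last first.
  by exists false => y v gap; case/existsP: nogap; exists y.
have /card_gt0P[v0 v0F] : 0 < #|F0| by rewrite cF0.
exists (P ((y0 |: F0) :\ v0) (+) (y0 < v0)) => y v gap vF.
have -> : y = y0.
  have le (u u' : 'I_N) : last_gap u -> last_gap u' -> u' <= u.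
    case/and3P=> _ _ /forallP/(_ u') H /and3P[uD uF _].
    by rewrite leqNgt; apply: contra uF => uu; move: H; rewrite uD uu.
  by apply/val_inj/eqP; rewrite eqn_leq !le.
case/and3P: gap0 => y0D y0F _; apply: flip_side_const => //.
by move: y0D; rewrite (in_outer hdm hN) in_blocks; lia.
Qed.

(** If D is contained in F0, then all members of [flipped] have the same single
    point v outside B, and a packet with two of them is that of v + U, for U in B with d + 1 elements; its
    remaining member is U itself, so the condition on f is that of a rank for
    the inner family, read backwards if v is right of B.  If not, a packet with
    two of them comes from elements p, q collapsed onto the last gap y of F0,
    and [flip_side] gives the same direction for all packets: any f that
    increases, or decreases, along all packets will do, and the empty
    inversion set provides one. *)
Lemma flip_rank : exists f : {set 'I_N} -> nat,
  {in flipped &, injective f} /\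
  forall K (p q : 'I_N), #|K| = d.+2 -> p \in K -> q \in K -> p < q ->
    K :\ p \in flipped -> K :\ q \in flipped ->
    (exists2 w, w \in K & K :\ w \notin flipped) /\
    forall w : 'I_N, w \in K -> K :\ w \notin flipped ->
      (f (K :\ p) < f (K :\ q)) = glue P P' (K :\ w) (+) (q < w).
Proof.
have orient_inj (f f' : {set 'I_N} -> nat) e (A : pred {set 'I_N}) :
    (forall s t, (f' s < f' t) = (if e then f t < f s else f s < f t)) ->
    {in A &, injective f} -> {in A &, injective f'}.
  move=> ff' fi s t sA tA E; apply: fi => //.
  have := ff' s t; have := ff' t s; rewrite E ltnn.
  by case: (e) => /=; clear; lia.
have [DF0|DF0] := boolP (D \subset F0).
  have : #|F0 :\: B| = 1.
    have -> : F0 :\: B = F0 :\: D.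
      apply/setP=> x; rewrite !in_setD in_blocks; have := subsetP F0X x.
      rewrite (in_outer hdm hN) in_blocks; case: (x \in F0); last by rewrite !andbF.
      by move=> /(_ isT); move: hdm; clear; lia.
    rewrite cardsD (setIidPr DF0) cF0 card_interval; first by rewrite (addnC j) addnK subSnn.
    by move: hdm hN; clear; lia.
  move=> /eqP/cards1P[v F0B].
  have v_out : (v \in F0) && (v \notin B).
    by have := set11 v; rewrite -F0B in_setD andbC.
  have SB L : L \in flipped -> L :\: B = [set v].
    rewrite in_set => /and3P[_ _ /eqP barL]; rewrite -F0B -barL.
    by apply/setP=> x; rewrite !in_setD; case: (boolP (x \in B)) => //= /mem_bar_out->.
  have [f ff] := orient_rank (j + m <= v) (fun L => g (L :&: B)).
  exists f; split.
    apply: (orient_inj _ _ _ _ ff) => S T SS TS E.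
    rewrite -(setID S B) -(setID T B) !SB //; congr (_ :|: _).
    case: gP' => gi _; apply: gi => //; rewrite inE subsetIr /=.
      have := cardsID B S; rewrite SB // cards1; move: SS; rewrite in_set.
      by case/and3P=> /eqP-> _ _; rewrite addn1 => -[->].
    have := cardsID B T; rewrite SB // cards1; move: TS; rewrite in_set.
    by case/and3P=> /eqP-> _ _; rewrite addn1 => -[->].
  move=> K p q cK pK qK pq pS qS.
  have KB : K :\: B = [set v].
    apply/setP=> x; have /setP/(_ x) := SB _ pS; have /setP/(_ x) := SB _ qS.
    rewrite !in_setD !in_set1; have [->|_] := eqVneq x p; last by [].
    by rewrite (ord_ltn_neq pq).
  have vK : v \in K by have := set11 v; rewrite -KB in_setD => /andP[].
  have [vB vF0] : v \notin B /\ v \in F0 by case/andP: v_out.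
  have KvB : K :\ v = K :&: B.
    apply/setP=> x; have /setP/(_ x) := KB; rewrite in_setD in_setD1 in_setI in_set1.
    by case: (x == v); case: (x \in K); case: (x \in B).
  have inB u : u \in K -> K :\ u \in flipped -> u \in B /\ u != v.
    move=> uK uS; have uv : u != v.
      apply/eqP=> uv; have := SB _ uS; rewrite uv KvB => /setP/(_ v).
      by rewrite in_set1 eqxx in_setD vB in_setI (negPf vB) andbF.
    split=> //; apply: contraT => uB; have /setP/(_ u) := KB.
    by rewrite in_setD uB uK in_set1 (negPf uv).
  have [pB pv] := inB p pK pS; have [qB qv] := inB q qK qS.
  split.
    by exists v => //; rewrite in_set KvB subsetIr andbF.
  move=> w wK wS; have {w wK wS} -> : w = v.
    apply: contraNeq wS => wv.
    have bw : (K :\ w) :\: B = [set v].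
      apply/setP=> x; have /setP/(_ x) := KB; rewrite !in_setD !in_set1.
      by have [->|_] := eqVneq x w; rewrite ?(negPf wv) ?andbF.
    rewrite in_set (cardD1_in wK cK) eqxx -setD_eq0 bw /=.
    rewrite (bar_narrow hdm hN _ bw) ?(cardD1_in wK cK) //.
    rewrite -(bar_narrow hdm hN (cardD1_in pK cK) (SB _ pS)).
    have -> /= : [set v] != set0 by apply/set0Pn; exists v; rewrite set11.
    by move: pS; rewrite in_set => /and3P[].
  have -> : (q < v) = (j + m <= v) by move: qB vB; rewrite !in_blockB; clear; lia.
  rewrite ff /glue KvB subsetIr.
  have KI u : (K :\ u) :&: B = (K :&: B) :\ u by rewrite setIDAC.
  rewrite !KI; case: gP' => gi gP.
  have cKB : #|K :&: B| = d.+1 by rewrite -KvB; exact: cardD1_in vK cK.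
  have [pKB qKB] : p \in K :&: B /\ q \in K :&: B by rewrite !in_setI pK qK.
  rewrite (gP (K :&: B) p q) ?subsetIr //.
  have ne : g ((K :&: B) :\ p) != g ((K :&: B) :\ q).
    apply/eqP=> /gi E; case/eqP: (ord_ltn_neq pq); apply: (setD1_inj pKB).
    have sub u : (K :&: B) :\ u \subset B.
      exact: subset_trans (subD1set _ _) (subsetIr _ _).
    by apply: E; rewrite inE sub ?(cardD1_in pKB cKB) ?(cardD1_in qKB cKB) /=.
  case: (j + m <= v); rewrite ?addbF ?addbT //.
  by rewrite -leqNgt [in RHS]leq_eqVlt eq_sym (negPf ne).
(* With the empty inversion set, f0 increases along every packet; the value e
   of [flip_side] tells whether it has to be reversed. *)
have [f0 [f0i f0P]] : exists f, ranks_on setT d.+1 (pred0 : pred {set 'I_N}) f.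
  by apply: consistent_ranks.
have [e He] := flip_side; have [f ff] := orient_rank e f0.
exists f; split.
  apply: (orient_inj _ _ _ _ ff) => S T SS TS; apply: f0i; rewrite inE subsetT.
    by move: SS; rewrite in_set => /and3P[].
  by move: TS; rewrite in_set => /and3P[].
move=> K p q cK pK qK pq pS qS.
have fpq : (f (K :\ p) < f (K :\ q)) = e.
  have := f0P K p q (subsetT K) cK pK qK pq => /= /esym lt_pq.
  rewrite ff lt_pq; case: (e) => //.
  rewrite ltn_neqAle leqNgt lt_pq andbT; apply/eqP => /esym E.
  case/eqP: (ord_ltn_neq pq); apply: (setD1_inj pK).
  by apply: f0i => //; rewrite inE subsetT ?(cardD1_in pK cK) ?(cardD1_in qK cK) /=.
have [pNB barp] : ~~ (K :\ p \subset B) /\ bar (K :\ p) = F0.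
  by move: pS; rewrite in_set => /and3P[_ ? /eqP].
have barq : bar (K :\ q) = F0.
  by move: qS; rewrite in_set => /and3P[_ _ /eqP].
have wide : 1 < #|K :\: B|.
  rewrite ltnNge leq_eqVlt ltnS leqn0; apply/negP=> /orP[/cards1P[v KB]|]; last first.
    rewrite cards_eq0 setD_eq0 => KB; case/negP: pNB.
    exact: subset_trans (subD1set _ _) KB.
  case/negP: DF0; rewrite -barp (bar_narrow hdm hN (v := v)) ?subsetUr //.
    exact: cardD1_in pK cK.
  apply/eqP; rewrite eqEsubset -{1}KB setSD ?subD1set //= sub1set.
  have /set0Pn[x] : (K :\ p) :\: B != set0 by rewrite setD_eq0.
  rewrite !in_setD => /and3P[xB xp xK].
  have /setP/(_ x) := KB; rewrite in_setD xB xK in_set1 => /esym/eqP <-.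
  by rewrite xB xp xK.
have [c [FX cF thr maxc barK]] := packet_wide hdm hN cK wide.
set F := fill m d j c K in FX cF thr maxc barK.
set y := collapse m j c p.
have yF : y \in F by exact: collapse_fill.
have Fy : F :\ y = F0 by rewrite -barp; have [_ ->] := barK p pK.
have yq : y = collapse m j c q.
  by apply: (setD1_inj yF); rewrite Fy -barq; have [_ ->] := barK q qK.
have pz : p \in zone N m j c.
  apply: contraT => pz; have := congr1 val yq; rewrite /= !(val_collapse hdm hN) (negPf pz).
  by move: pz pq; case: ifP; rewrite !in_zone; clear; lia.
have yc : y = j + c :> nat by rewrite (val_collapse hdm hN) pz.
have qz : q \in zone N m j c.
  apply: contraT => qz; have := congr1 val yq; rewrite /= yc (val_collapse hdm hN) (negPf qz).
  by move: pz pq; rewrite in_zone; clear; lia.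
have yz : y \in zone N m j c by move: pz; rewrite !in_zone yc; clear; lia.
have gap : last_gap y.
  have yF0 : y \notin F0 by rewrite -Fy in_setD1 eqxx.
  have yD : y \in D by move: yF; rewrite in_fill yz in_blocks yc; clear; lia.
  rewrite /last_gap yD yF0 /=; apply/forallP=> z; apply/implyP => zD; apply/implyP => yz'.
  rewrite -Fy in_setD1 in_fill eq_sym (ord_ltn_neq yz').
  by move: zD yz' hdm; rewrite yc in_zone in_blocks; case: ifP; clear; lia.
have FE : F = y |: F0 by rewrite -Fy setD1K.
have flippedE u : u \in K -> (K :\ u \in flipped) = (collapse m j c u == y).
  move=> uK; have [uNB barE] := barK u uK.
  rewrite in_set (cardD1_in uK cK) eqxx uNB barE -Fy.
  by apply/eqP/eqP=> [|->//]; apply: setD1_inj; exact: collapse_fill.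
split.
  have /card_gt0P[w] := ltnW wide; rewrite in_setD => /andP[wB wK].
  exists w; rewrite // flippedE //; apply: contra wB => /eqP wy.
  have := congr1 val wy; rewrite /= (val_collapse hdm hN) yc.
  by move: yz; case: ifP; rewrite !in_zone in_blockB yc; clear; lia.
move=> w wK; rewrite flippedE // => wy.
have wz : w \notin zone N m j c.
  apply: contra wy => wz; rewrite -val_eqE /= (val_collapse hdm hN) wz yc; exact: eqxx.
have cw : collapse m j c w = w by rewrite /collapse (negPf wz).
have [wNB barE] := barK w wK.
rewrite fpq /glue (negPf wNB) barE cw.
have -> : (q < w) = (y < w).
  by move: wz qz; rewrite !in_zone yc; clear; lia.
rewrite FE He // -Fy in_setD1 -{1}cw wy -cw; exact: collapse_fill.
Qed.

End Flip.

End Glue.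

(** * Insertion and the flip order *)

Lemma preimageE k N (f : nat -> nat) (g : 'I_k -> 'I_N) (L : {set 'I_N}) :
  (forall i, g i = f i :> nat) -> preimage k f L = g @^-1: L.
Proof.
move=> gf; apply/setP=> i; rewrite !inE; apply/existsP/idP => [[x /andP[xL]]|gL].
  by rewrite -gf => /eqP/val_inj<-.
by exists (g i); rewrite gL gf eqxx.
Qed.

Section Insertion.

Variables n m d j : nat.
Hypotheses (hd : 0 < d) (hdn : d <= n) (hdm : d <= m) (hj : j <= n - d).

Notation N := (n + m - d).
Notation B := (blockB N m j).
Notation bar := (insertion_bar m d j).
Notation outer := (outer N m d j).
Implicit Types (L : {set 'I_N}) (b : {set {set 'I_n}}) (c : {set {set 'I_m}}).

Lemma blockB_fits : j + m <= N.
Proof. by lia. Qed.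

Lemma phi_subproof (i : 'I_n) : phi m d j i < N.
Proof. by rewrite /phi; have := ltn_ord i; case: ifP; lia. Qed.

Lemma shift_subproof (i : 'I_m) : j + i < N.
Proof. by have := ltn_ord i; lia. Qed.

Definition phi_ord (i : 'I_n) : 'I_N := Ordinal (phi_subproof i).
Definition shift_ord (i : 'I_m) : 'I_N := Ordinal (shift_subproof i).

Lemma phi_ord_mono x y : (phi_ord x < phi_ord y) = (x < y).
Proof. by rewrite /= /phi; do 2!case: ifP; lia. Qed.

Lemma shift_ord_mono x y : (shift_ord x < shift_ord y) = (x < y).
Proof. by rewrite /= ltn_add2l. Qed.

Lemma codom_phi_ord : phi_ord @: setT = outer.
Proof.
apply/setP=> x; rewrite (in_outer hdm blockB_fits); have xN := ltn_ord x.
apply/imsetP/idP => [[i _ ->]|xo].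
  by rewrite /= /phi; have := ltn_ord i; case: ifP; lia.
have lt : (if x < j + d then nat_of_ord x else x - (m - d)) < n by case: ifP xo; lia.
exists (Ordinal lt) => //; apply: val_inj; rewrite /= /phi.
by move: xo; case: (ltnP x (j + d)) => /=; case: ifP; lia.
Qed.

Lemma codom_shift_ord : shift_ord @: setT = B.
Proof.
apply/setP=> x; rewrite in_blockB; apply/imsetP/idP => [[i _ ->]|xB].
  by rewrite /=; have := ltn_ord i; lia.
have lt : x - j < m by lia.
by exists (Ordinal lt) => //; apply: val_inj => /=; lia.
Qed.

Definition on_outer b : pred {set 'I_N} := fun L => phi_ord @^-1: L \in b.
Definition on_B c : pred {set 'I_N} := fun L => shift_ord @^-1: L \in c.

Lemma bar_id L : L \subset outer -> bar L = L.
Proof.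
move=> /subsetP LX; have fits := blockB_fits.
have LX' x : x \in L -> (x < j + d) || (j + m <= x).
  by move=> /LX; rewrite in_outer.
rewrite (@insertion_bar_fill _ _ _ _ hdm fits d).
  apply/setP=> x; rewrite in_fill in_zone; case: ifP => // xz.
  by apply/idP/idP => [|/LX']; move: xz; clear; lia.
rewrite /threshold leqnn subnn cards_eq0 -subset0; apply/subsetP=> x.
rewrite in_setI in_zone => /andP[/LX']; clear; lia.
Qed.

Lemma in_insertion b c L : #|L| = d.+1 ->
  (L \in insertion d j b c) = glue m d j (on_outer b) (on_B c) L.
Proof.
move=> cL; rewrite in_set in_set cL eqxx /= /glue /on_outer /on_B -/outer.
rewrite !(preimageE (g := phi_ord)) // !(preimageE (g := shift_ord)) //.
by case: ifP => // _; case: ifP => // LX; rewrite bar_id.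
Qed.

Lemma insertion_ksubsets b c : insertion d j b c \subset ksubsets N d.+1.
Proof. by apply/subsetP=> L; rewrite in_set => /andP[]. Qed.

Lemma on_outer_consistent b : higher_bruhat d b -> consistent_on outer d (on_outer b).
Proof.
case/(higher_bruhatP _ hd) => _ bc; rewrite -codom_phi_ord.
by apply: consistent_pull bc; exact: phi_ord_mono.
Qed.

Lemma on_B_ranks c : higher_bruhat d c -> exists g, ranks_on B d (on_B c) g.
Proof.
case/(higher_bruhat_ranksP _ hd) => _ [f fP]; rewrite -codom_shift_ord.
by exists (fun L => f (shift_ord @^-1: L)); apply: ranks_pull fP; exact: shift_ord_mono.
Qed.

Lemma insertion_consistent b c : higher_bruhat d b -> higher_bruhat d c ->
  consistent_on setT d (mem (insertion d j b c)).
Proof.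
move=> hb /on_B_ranks[g /ranks_consistent gc].
apply: consistent_on_eq (glue_consistent hdm blockB_fits (on_outer_consistent hb) gc).
by move=> L cL; rewrite /= in_insertion.
Qed.

Lemma insertion_bruhat b c : higher_bruhat d b -> higher_bruhat d c ->
  higher_bruhat d (insertion d j b c).
Proof.
move=> hb hc; apply/(higher_bruhatP _ hd); split; first exact: insertion_ksubsets.
exact: insertion_consistent.
Qed.

(** Only one subset of B is shifted onto the flipped set, and the other clauses
    of the insertion do not look at the inner family: a single flip. *)
Lemma insertion_flip_inner b c c' : higher_bruhat d b -> increasing_flip d c c' ->
  flip_le d (insertion d j b c) (insertion d j b c').
Proof.
move=> hb [hc hc' [K]]; rewrite in_setD => /andP[Kc KK] c'E.
split; first exact: insertion_bruhat.
apply: rt_step; split; try exact: insertion_bruhat.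
have cK : #|K| = d.+1 by move: KK; rewrite in_set => /eqP.
have KB : shift_ord @: K \subset B by rewrite -codom_shift_ord imsetS ?subsetT.
have cK' : #|shift_ord @: K| = d.+1.
  by rewrite card_imset; [exact: cK|exact: (ltn_mono_inj shift_ord_mono)].
have KK' : shift_ord @^-1: (shift_ord @: K) = K.
  exact: (preimset_imset shift_ord_mono).
exists (shift_ord @: K).
  by rewrite in_setD in_insertion // /glue KB /on_B KK' Kc in_set cK' eqxx.
apply/setP=> L; rewrite in_setU1.
have [cL|cL] := eqVneq #|L| d.+1; last first.
  have notin e e' : (L \in insertion d j e e') = false.
    by rewrite in_set in_set (negPf cL).
  rewrite !notin orbF; apply/esym/eqP => E.
  by case/eqP: cL; rewrite E.
rewrite !in_insertion // /glue /on_B c'E in_setU1.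
have [LB|LB] := boolP (L \subset B).
  congr (_ || _); apply/eqP/eqP=> [<-|->//].
  by rewrite imset_preimset // codom_shift_ord.
case: eqP => // E; by case/negP: LB; rewrite E.
Qed.

(** All sets whose bar is the flipped set enter, in the order of [flip_rank]. *)
Lemma insertion_flip_outer b b' c : higher_bruhat d c -> increasing_flip d b b' ->
  flip_le d (insertion d j b c) (insertion d j b' c).
Proof.
move=> hc [hb hb' [K]]; rewrite in_setD => /andP[Kb KK] b'E.
have cK : #|K| = d.+1 by move: KK; rewrite in_set => /eqP.
pose F0 := phi_ord @: K.
have F0X : F0 \subset outer by rewrite -codom_phi_ord imsetS ?subsetT.
have cF0 : #|F0| = d.+1.
  by rewrite card_imset; [exact: cK|exact: (ltn_mono_inj phi_ord_mono)].
have KF0 : phi_ord @^-1: F0 = K by exact: (preimset_imset phi_ord_mono).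
have on_b' L : L \subset outer -> on_outer b' L = (L == F0) || on_outer b L.
  move=> LX; rewrite /on_outer b'E in_setU1; congr (_ || _).
  apply/eqP/eqP=> [LK|->//]; rewrite /F0 -LK imset_preimset //.
  by rewrite codom_phi_ord.
have [g gP] := on_B_ranks hc.
have PF0 : ~~ on_outer b F0 by rewrite /on_outer KF0.
have bc := on_outer_consistent hb.
have b'c : consistent_on outer d (fun L => (L == F0) || on_outer b L).
  move=> L x y z LX; rewrite -!on_b' ?(subset_trans (subD1set _ _) LX) //.
  by apply: on_outer_consistent.
have [f [fi fP]] := flip_rank hdm blockB_fits F0X cF0 PF0 bc b'c gP.
have E : insertion d j b' c = insertion d j b c :|: flipped m d j F0.
  apply/setP=> L; rewrite in_setU; have [cL|cL] := eqVneq #|L| d.+1; last first.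
    rewrite (in_set (fun L => [&& #|L| == d.+1, _ & _])) (negPf cL) orbF.
    have notin e e' : (L \in insertion d j e e') = false.
      by rewrite in_set in_set (negPf cL).
    by rewrite !notin.
  rewrite !in_insertion // /glue (in_set (fun L => [&& #|L| == d.+1, _ & _])) cL eqxx /=.
  have [LB|LB] := boolP (L \subset B); first by rewrite orbF.
  by rewrite on_b' 1?orbC // (bar_outer hdm blockB_fits).
rewrite E; apply: flip_le_by_rank fi _ _ _ => //.
- exact: insertion_ksubsets.
- by apply/subsetP=> L; rewrite in_set => /and3P[cL _ _]; rewrite in_set.
- rewrite disjoint_sym disjoints_subset; apply/subsetP=> L.
  rewrite in_set in_setC => /and3P[/eqP cL LB /eqP barL].
  by rewrite in_insertion // /glue (negPf LB) barL.
- exact: insertion_consistent.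
- by rewrite -E; exact: insertion_consistent.
move=> L p q cL pL qL pq pS qS; have [ex H] := fP L p q cL pL qL pq pS qS.
by split=> // w wL wS; rewrite in_insertion ?(cardD1_in wL cL) //; exact: H.
Qed.

End Insertion.

Lemma flip_le_lift n n' d (F : {set {set 'I_n}} -> {set {set 'I_n'}}) b b' :
    (forall c, higher_bruhat d c -> higher_bruhat d (F c)) ->
    (forall c c', increasing_flip d c c' -> flip_le d (F c) (F c')) ->
  flip_le d b b' -> flip_le d (F b) (F b').
Proof.
move=> Fhb Fflip [hb bb'].
suff [] : higher_bruhat d b' /\ flip_le d (F b) (F b') by [].
elim: bb' hb => {b b'} [b b' flip _|b hb|b1 b2 b3 _ IH1 _ IH2 hb1].
- by split; [case: flip|exact: Fflip].
- by split=> //; split; [exact: Fhb|exact: rt_refl].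
have [hb2 F12] := IH1 hb1; have [hb3 F23] := IH2 hb2.
by split=> //; exact: flip_le_trans F12 F23.
Qed.

Theorem theorem11p1 (n m d j : nat)
    (hd : 1 <= d) (hdn : d <= n) (hdm : d <= m) (hj : j <= n - d)
    (b bt : {set {set 'I_n}}) (b' b'' : {set {set 'I_m}})
    (hb : higher_bruhat d b) (hbt : higher_bruhat d bt)
    (hb' : higher_bruhat d b') (hb'' : higher_bruhat d b'') :
  (flip_le d b' b'' ->
     flip_le d (insertion d j b b') (insertion d j b b'')) /\
  (flip_le d b bt ->
     flip_le d (insertion d j b b') (insertion d j bt b')).
Proof.
split.
  apply: flip_le_lift => [c hc|c c' flip]; first exact: insertion_bruhat.
  exact: insertion_flip_inner.
apply: (flip_le_lift (F := fun c => insertion d j c b')) => [c hc|c c' flip].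
  exact: insertion_bruhat.
exact: insertion_flip_outer.
Qed.
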